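(* Let $n\ge 2$ be an integer. There is a function $f\colon \mathbb{Z}_{\ge 0}\to\mathbb{Q}$ of the form $f(z)=a z+c$, with constants $a,c$ depending only on $n$ and with $a>0$, such that for every integer $m$ coprime to $n$, with associated automorphism $\beta=\beta_m$ of the affine Weyl group $W_a$, and for every $v\in W_a$, $$\ell(\beta(v)v^{-1})\ \ge\ f(\ell(v)).$$ In particular, for every such $m$: for a given $w\in W_a$ there are at most finitely many $v\in W_a$ with $\beta(v)v^{-1}=w$, and for any $r>0$ the set $\{v\in W_a : \ell(\beta(v)v^{-1})<r\}$ is finite. Moreover, one can take $$f(z)=\frac{2}{n-1}\,z-\frac{2n(2n-3)}{n-1}.$$
   Context: $W_a$ denotes the affine Weyl group of $\mathrm{GL}_n$ (affine type $\tilde A_{n-1}$): $W_a=Q^\vee\rtimes W$, where $W=S_n$ is the finite Weyl group and $Q^\vee=\{\lambda\in\mathbb{Z}^n:\sum_i\lambda_i=0\}$ is the coroot lattice; the translation by $\lambda$ is written $\epsilon^\lambda$. It is a Coxeter group with distinguished generators $s_0,s_1,\dots,s_{n-1}$, where $s_i$ ($1\le i\le n-1$) is the simple transposition $(i,i+1)$ of $S_n$ and $s_0=\epsilon^{\theta^\vee}s_\theta$, with $\theta$ the highest positive root, $\theta^\vee=(1,0,\dots,0,-1)$ its coroot and $s_\theta=(1,n)$ the associated reflection. $\ell$ is the length function with respect to these generators. Set $s_i:=s_{i \bmod n}$ for all $i\in\mathbb{Z}$. For an integer $m$ coprime to $n$, $\beta=\beta_m$ is the automorphism of $W_a$ determined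 by $\beta(s_i)=s_{i+m}$ for all $i\in\mathbb{Z}$. (It arises as the automorphism of $W_a$ induced by conjugation with the superbasic element $b\in\mathrm{GL}_n(L)$, $L=\bar k((\epsilon))$, with $\bar k$ an algebraic closure of a finite field, given by $e_i\mapsto e_{i+m}$, where $e_0,\dots,e_{n-1}$ is the standard basis of $L^n$ and $e_{i+n}=\epsilon e_i$.) *)

(* Defs.v *)
From HB Require Import structures.
From mathcomp Require Import all_boot all_order all_algebra all_fingroup.

Set Implicit Arguments.
Unset Strict Implicit.
Unset Printing Implicit Defensive.

Import GRing.Theory.
Local Open Scope ring_scope.

(* The extended affine Weyl group Z^n >< S_n of GL_n. Coordinates are numbered
   from 0 to n-1. ExtAff l s is the element eps^l s, which acts on the
   basis by e_i |-> eps^(l_(s i)) e_(s i). *)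
Record ext_affine (n : nat) := ExtAff {
  transl : {ffun 'I_n -> int};
  linear_part : 'S_n
}.

Definition pair_of_ext n (x : ext_affine n) := (transl x, linear_part x).
Definition ext_of_pair n (p : {ffun 'I_n -> int} * 'S_n) := ExtAff p.1 p.2.
Lemma pair_of_extK n : cancel (@pair_of_ext n) (@ext_of_pair n).
Proof. by case. Qed.
HB.instance Definition _ n :=
  Choice.copy (ext_affine n) (can_type (@pair_of_extK n)).

Section ExtAffine.
Variable n : nat.
Implicit Types (l : {ffun 'I_n -> int}) (s : 'S_n) (x : ext_affine n).

(* The action of S_n on Z^n sending e_i to e_(s i). *)
Definition perm_act s l : {ffun 'I_n -> int} := [ffun i => l ((s^-1)%g i)].

Lemma perm_act1 l : perm_act 1%g l = l.
Proof. by apply/ffunP => i; rewrite ffunE invg1 perm1. Qed.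

Lemma perm_actM s t l : perm_act (t * s)%g l = perm_act s (perm_act t l).
Proof. by apply/ffunP => i; rewrite !ffunE invMg permM. Qed.

Lemma perm_actD s l1 l2 : perm_act s (l1 + l2) = perm_act s l1 + perm_act s l2.
Proof. by apply/ffunP => i; rewrite !ffunE. Qed.

Lemma perm_actN s l : perm_act s (- l) = - perm_act s l.
Proof. by apply/ffunP => i; rewrite !ffunE. Qed.

Lemma perm_act0 s : perm_act s 0 = 0.
Proof. by apply/ffunP => i; rewrite !ffunE. Qed.

Lemma sum_perm_act s l : \sum_i perm_act s l i = \sum_i l i.
Proof.
rewrite [RHS](reindex_inj (@perm_inj _ s^-1)%g) /=.
by apply: eq_bigr => i _; rewrite ffunE.
Qed.

Definition ext_one : ext_affine n := ExtAff 0 1%g.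
(* eps^l s * eps^m t = eps^(l + s m) (s o t), where the composite s o t is
   the product (t * s)%g of 'S_n. *)
Definition ext_mul x y : ext_affine n :=
  ExtAff (transl x + perm_act (linear_part x) (transl y))
         (linear_part y * linear_part x)%g.
Definition ext_inv x : ext_affine n :=
  ExtAff (- perm_act (linear_part x)^-1%g (transl x)) (linear_part x)^-1%g.

Lemma ext_mulA : associative ext_mul.
Proof.
by move=> x y z; rewrite /ext_mul /= perm_actD perm_actM addrA mulgA.
Qed.
Lemma ext_mul1 : left_id ext_one ext_mul.
Proof. by case=> l s; rewrite /ext_mul /= perm_act1 add0r mulg1. Qed.
Lemma ext_mulr1 : right_id ext_one ext_mul.
Proof. by case=> l s; rewrite /ext_mul /= perm_act0 addr0 mul1g. Qed.
Lemma ext_mulV : left_inverse ext_one ext_inv ext_mul.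
Proof. by case=> l s; rewrite /ext_mul /= addNr mulgV. Qed.
Lemma ext_mulrV : right_inverse ext_one ext_inv ext_mul.
Proof.
case=> l s; rewrite /ext_mul /= perm_actN -perm_actM mulVg perm_act1.
by rewrite subrr.
Qed.

HB.instance Definition _ := isGroup.Build (ext_affine n)
  ext_mulA ext_mul1 ext_mulr1 ext_mulV ext_mulrV.

Definition in_affine_weyl x := \sum_i transl x i == 0.

Lemma sum_translM x y :
  \sum_i transl (x * y)%g i = \sum_i transl x i + \sum_i transl y i.
Proof.
rewrite -(sum_perm_act (linear_part x) (transl y)) -big_split /=.
by apply: eq_bigr => i _; rewrite ffunE.
Qed.

Lemma sum_transl1 : \sum_i transl (1 : ext_affine n)%g i = 0.
Proof. by rewrite big1 // => i _; rewrite ffunE. Qed.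

Lemma sum_translV x : \sum_i transl (x^-1)%g i = - \sum_i transl x i.
Proof.
by apply/eqP; rewrite -addr_eq0 -sum_translM mulVg sum_transl1.
Qed.

Lemma in_affine_weyl_closed : group_closed in_affine_weyl.
Proof.
split=> [|x y]; rewrite /in_affine_weyl !unfold_in ?sum_transl1 //.
by move=> /eqP sx /eqP sy; rewrite sum_translM sum_translV sx sy subr0.
Qed.

End ExtAffine.

(* The affine Weyl group W_a = Q^vee >< S_n. *)
Record affine_weyl (n : nat) :=
  AffineWeyl { ext_val : ext_affine n; _ : in_affine_weyl ext_val }.

HB.instance Definition _ n := [isSub for @ext_val n].
HB.instance Definition _ n := [Choice of affine_weyl n by <:].
HB.instance Definition _ n := SubChoice_isSubGroup.Build
  (ext_affine n) (@in_affine_weyl n) (affine_weyl n) (@in_affine_weyl_closed n).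

Section Generators.
Variable n : nat.

Definition std_vec (i : 'I_n) : {ffun 'I_n -> int} := [ffun j => (j == i)%:Z].

Lemma sum_std_vec i : \sum_j std_vec i j = 1.
Proof.
rewrite (bigD1 i) //= ffunE eqxx big1 ?addr0 // => j ji.
by rewrite ffunE (negPf ji).
Qed.

(* With coordinates numbered from 0, s_i for 0 < i < n exchanges i-1 and i.
   For i = 0, ord_pred i is n-1, so that the formula gives the reflection
   s_theta, which the translation by theta^vee = e_0 - e_(n-1) turns into s_0. *)
Definition ext_gen (i : 'I_n) : ext_affine n :=
  ExtAff (if i == 0%N :> nat then std_vec i - std_vec (ord_pred i) else 0)
         (tperm (ord_pred i) i).

Lemma ext_gen_subproof i : in_affine_weyl (ext_gen i).
Proof.
rewrite /in_affine_weyl /=; case: ifP => _.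
  under eq_bigr do rewrite ffunE (ffunE (fun a => - std_vec _ a)).
  by rewrite big_split /= sumrN !sum_std_vec subrr.
by rewrite big1 // => j _; rewrite ffunE.
Qed.

Definition gen (i : 'I_n) : affine_weyl n := AffineWeyl (ext_gen_subproof i).

(* gen_mod i is s_(i mod n); the default value 1 is reached only if n = 0. *)
Definition gen_mod (i : int) : affine_weyl n :=
  if insub `|(i %% n)%Z|%N is Some j then gen j else 1%g.

End Generators.

Section Length.
Variable n : nat.
Implicit Types (v w : affine_weyl n) (l : {ffun 'I_n -> int}) (s : 'S_n).

Definition has_word (v : affine_weyl n) (k : nat) : bool :=
  [exists t : k.-tuple 'I_n, (\prod_(i <- t) gen i)%g == v].

Lemma has_wordP v :
  (exists t : seq 'I_n, (\prod_(i <- t) gen i)%g = v) <-> exists k, has_word v k.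
Proof.
split=> [[t <-]|[k /existsP[t /eqP <-]]]; last by exists t.
by exists (size t); apply/existsP; exists (in_tuple t).
Qed.

Definition spanned (x : ext_affine n) :=
  exists t : seq 'I_n, (\prod_(i <- t) ext_gen i)%g = x.

Lemma spannedM x y : spanned x -> spanned y -> spanned (x * y)%g.
Proof. by move=> [t <-] [u <-]; exists (t ++ u); rewrite big_cat. Qed.

Lemma spanned1 : spanned 1%g.
Proof. by exists [::]; rewrite big_nil. Qed.

Lemma spanned_gen i : spanned (ext_gen i).
Proof. by exists [:: i]; rewrite big_seq1. Qed.

Lemma ext_mulE (l1 l2 : {ffun 'I_n -> int}) (s1 s2 : 'S_n) :
  (ExtAff l1 s1 * ExtAff l2 s2)%g = ExtAff (l1 + perm_act s1 l2) (s2 * s1)%g.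
Proof. by []. Qed.

Lemma spanned_perm_mul s t :
  spanned (ExtAff 0 s) -> spanned (ExtAff 0 t) -> spanned (ExtAff 0 (s * t)%g).
Proof.
by move=> Hs Ht; move: (spannedM Ht Hs); rewrite ext_mulE perm_act0 addr0.
Qed.

Lemma ord_pred_val (i : 'I_n) : (0 < i)%N -> ord_pred i = i.-1 :> nat.
Proof.
case: i => i lt_in /= i_gt0; rewrite -(prednK i_gt0) addSn /=.
by rewrite modnDr modn_small // (leq_ltn_trans (leq_pred i)).
Qed.

Lemma spanned_tperm (i j : 'I_n) : spanned (ExtAff 0 (tperm i j)).
Proof.
wlog lt_ij : i j / (i < j)%N.
  move=> H; have [/H//|/H|/val_inj->] := ltngtP i j; first by rewrite tpermC.
  by rewrite tperm1; apply: spanned1.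
have [d] := ubnP (j - i); elim: d i j lt_ij => // d IHd i j lt_ij le_d.
have j_gt0 : (0 < j)%N by apply: leq_ltn_trans lt_ij.
have predj := ord_pred_val j_gt0.
have Hj : spanned (ExtAff 0 (tperm (ord_pred j) j)).
  have := spanned_gen j; rewrite /ext_gen; case: eqP => // j0.
  by rewrite j0 in j_gt0.
have [->//|ne_i] := eqVneq i (ord_pred j).
have lt_i : (i < ord_pred j)%N.
  by rewrite ltn_neqAle (inj_eq (@ord_inj n)) ne_i predj -ltnS prednK.
have ne_ij : i != j by rewrite -val_eqE /= ltn_eqF.
have ne_pj : ord_pred j != j by rewrite -(inj_eq (@ord_inj n)) neq_ltn predj prednK ?leqnn.
have -> : tperm i j = ((tperm i (ord_pred j)) ^ tperm (ord_pred j) j)%g.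
  by rewrite tpermJ tpermL tpermD // eq_sym.
rewrite conjgE tpermV.
apply: spanned_perm_mul => //; apply: spanned_perm_mul => //.
apply: IHd => //; rewrite predj.
by rewrite (leq_trans _ (ltnSE le_d : _)) // ltn_sub2r // prednK.
Qed.

Lemma spanned_perm s : spanned (ExtAff 0 s).
Proof.
have [ts -> _] := prod_tpermP s.
elim: ts => [|t ts IH]; first by rewrite big_nil; apply: spanned1.
by rewrite big_cons; apply: spanned_perm_mul => //; apply: spanned_tperm.
Qed.

Lemma spanned_perm_act s l :
  spanned (ExtAff l 1%g) -> spanned (ExtAff (perm_act s l) 1%g).
Proof.
move=> /(spannedM (spanned_perm s))/spannedM/(_ (spanned_perm s^-1%g)).
by rewrite !ext_mulE perm_act0 addr0 add0r mul1g mulVg.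
Qed.

Lemma spanned_translD l1 l2 : spanned (ExtAff l1 1%g) ->
  spanned (ExtAff l2 1%g) -> spanned (ExtAff (l1 + l2) 1%g).
Proof.
by move=> H1 /(spannedM H1); rewrite ext_mulE perm_act1 mulg1.
Qed.

Lemma perm_act_std s i : perm_act s (std_vec i) = std_vec (s i).
Proof.
apply/ffunP => j; rewrite !ffunE; congr (nat_of_bool _)%:Z.
by apply/eqP/eqP => [<-|->]; rewrite ?permKV ?permK //.
Qed.

Lemma spanned_root (i j : 'I_n) :
  spanned (ExtAff (std_vec i - std_vec j) 1%g).
Proof.
have [->|ne_ij] := eqVneq i j; first by rewrite subrr; apply: spanned1.
have n_gt0 : (0 < n)%N by apply: leq_ltn_trans (ltn_ord i).
pose o := Ordinal n_gt0; pose p := ord_pred o.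
have ne_op : o != p.
  apply: contra_neq ne_ij => op.
  have n1 : (n <= 1)%N.
    have := congr1 val op; rewrite /= modn_small ?prednK //.
    by case: (n) => [|[|]].
  apply/val_inj; move: (leq_trans (ltn_ord i) n1) (leq_trans (ltn_ord j) n1).
  by rewrite !ltnS !leqn0 => /eqP i0 /eqP j0; rewrite -[RHS]/(nat_of_ord j) j0.
have H0 : spanned (ExtAff (std_vec o - std_vec p) 1%g).
  have := spannedM (spanned_gen o) (spanned_tperm p o).
  by rewrite ext_mulE /= perm_act0 addr0 tperm2.
pose s := (tperm o i * tperm (tperm o i p) j)%g.
have so : s o = i.
  rewrite permM tpermL tpermD //; last by rewrite eq_sym.
  by apply: contraNneq ne_op => /(canRL (tpermK _ _)); rewrite tpermR => ->.
have sp : s p = j by rewrite permM tpermL.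
have := spanned_perm_act s H0.
by rewrite perm_actD perm_actN !perm_act_std so sp.
Qed.

Lemma spannedP x : in_affine_weyl x -> spanned x.
Proof.
case: x => l s; rewrite /in_affine_weyl /= => /eqP sum0.
have -> : ExtAff l s = (ExtAff l 1 * ExtAff 0 s)%g.
  by rewrite ext_mulE perm_act0 addr0 mulg1.
apply: spannedM (spanned_perm s).
have [i0 _|no] := pickP (@predT 'I_n); last first.
  have -> : l = 0 by apply/ffunP => i; case/negP: (negbT (no i)).
  exact: spanned1.
have -> : l = \sum_i (std_vec i - std_vec i0) *~ l i.
  apply/ffunP => j; rewrite sum_ffunE.
  have E i : ((std_vec i - std_vec i0) *~ l i) j
           = std_vec i j * l i - std_vec i0 j * l i.
    by rewrite ffunMzE !ffunE -mulrzz mulrzBl !mulrzz.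
  rewrite (eq_bigr _ (fun i _ => E i)) sumrB -mulr_sumr sum0 mulr0 subr0.
  rewrite (bigD1 j) //= ffunE eqxx mul1r big1 ?addr0 // => i /negPf ij.
  by rewrite ffunE eq_sym ij mul0r.
elim/big_ind: _ => [||i _]; [exact: spanned1 | exact: spanned_translD |].
have Hn (k : nat) a b : spanned (ExtAff ((std_vec a - std_vec b) *+ k) 1%g).
  elim: k => [|k IH]; first by rewrite mulr0n; apply: spanned1.
  by rewrite mulrS; apply: spanned_translD IH; apply: spanned_root.
case: (l i) => k; first exact: Hn.
by rewrite NegzE mulrNz -mulNrz opprB; apply: Hn.
Qed.

Lemma word_exists v : exists k, has_word v k.
Proof.
apply/has_wordP; have [t tv] := spannedP (valP v); exists t.
apply: val_inj; rewrite -tv; elim: t {tv} => [|i t IH].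
  by rewrite !big_nil.
by rewrite !big_cons -IH.
Qed.

(* The Coxeter length: the least number of factors in a word in s_0, ...,
   s_(n-1) representing v. *)
Definition len v : nat := ex_minn (word_exists v).

End Length.

(* The automorphism beta_m, determined by s_i |-> s_(i + m). *)
Definition is_beta n (m : int) (beta : affine_weyl n -> affine_weyl n) : Prop :=
  [/\ bijective beta,
      {morph beta : x y / (x * y)%g} &
      forall i : int, beta (gen_mod n i) = gen_mod n (i + m)].

Lemma gen_modE n (i : 'I_n) : gen_mod n i = gen i.
Proof.
rewrite /gen_mod modz_nat modn_small //=.
by case: insubP => [j _ ji|/negP//]; congr gen; apply: val_inj.
Qed.

Lemma is_beta_uniq n (m : int) (beta beta' : affine_weyl n -> affine_weyl n) :
  is_beta m beta -> is_beta m beta' -> beta =1 beta'.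
Proof.
move=> [_ bM bg] [_ bM' bg'] v.
have b1 (b : affine_weyl n -> affine_weyl n) :
    {morph b : x y / (x * y)%g} -> b 1%g = 1%g.
  by move=> H; apply: (@mulgI _ (b 1%g)); rewrite -H !mulg1.
have [t <-] := (has_wordP v).2 (word_exists v).
elim: t => [|i t IH]; first by rewrite big_nil !b1.
by rewrite big_cons bM bM' IH -gen_modE bg bg'.
Qed.

Section BetaExists.
Variable n : nat.

(* The element e_i |-> e_(i+1), where e_n = eps e_0; conjugation by its m-th
   power is beta_m. *)
Definition ext_rot : ext_affine n :=
  ExtAff [ffun j : 'I_n => (j == 0%N :> nat)%:Z] (perm (@ordS_inj n)).

Lemma in_affine_weylJ (x y : ext_affine n) :
  in_affine_weyl y -> in_affine_weyl (x * y * x^-1)%g.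
Proof.
by rewrite /in_affine_weyl => /eqP y0; rewrite !sum_translM sum_translV y0 addr0 subrr.
Qed.

Definition conj_by (x : ext_affine n) (v : affine_weyl n) : affine_weyl n :=
  AffineWeyl (in_affine_weylJ x (valP v)).

Lemma conj_byM x : {morph conj_by x : v w / (v * w)%g}.
Proof. by move=> v w; apply: val_inj; rewrite /= !mulgA mulgKV. Qed.

Lemma conj_byK x : cancel (conj_by x) (conj_by x^-1%g).
Proof.
by move=> v; apply: val_inj; rewrite /= invgK !mulgA mulVg mul1g mulgKV.
Qed.

Lemma conj_by_comp x y v : conj_by (x * y)%g v = conj_by x (conj_by y v).
Proof. by apply: val_inj; rewrite /= invMg !mulgA. Qed.

Lemma conj_rot_gen (i : 'I_n) : conj_by ext_rot (gen i) = gen (ordS i).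
Proof.
apply: val_inj; apply: (canLR (mulgK _)).
rewrite /= /ext_gen !ext_mulE ordSK.
have -> : (perm (@ordS_inj n) * tperm i (ordS i) =
           tperm (ord_pred i) i * perm (@ordS_inj n))%g.
  by rewrite [RHS]conjgC tpermJ !permE ord_predK.
congr ExtAff.
have n_gt0 : (0 < n)%N by apply: leq_ltn_trans (ltn_ord i).
pose o := Ordinal n_gt0.
have eq0 (k : 'I_n) : (k == 0%N :> nat) = (k == o) by [].
have -> : [ffun j : 'I_n => (j == 0%N :> nat)%:Z] = std_vec o by [].
rewrite !eq0 perm_act_std; have [->|ne_io] := eqVneq i o.
  rewrite tpermL perm_actD perm_actN !perm_act_std !permE ord_predK.
  by case: eqP => [->|_]; rewrite ?subrr add0r ?addr0 // addrC subrK.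
rewrite perm_act0 addr0; have [Si|ne_So] := eqVneq (ordS i) o.
  by rewrite Si tpermR subrK.
by rewrite tpermD // add0r.
Qed.

End BetaExists.

Lemma beta_exists n (m : int) :
  (0 < n)%N -> exists beta : affine_weyl n -> affine_weyl n, is_beta m beta.
Proof.
move=> n_gt0.
have n0 : (n : int) != 0 by rewrite -lt0n.
have [k km] : exists k : nat, k = `|(m %% n)%Z|%N by eexists.
have {}km : (m %% n)%Z = k by rewrite km gez0_abs // modz_ge0.
exists (conj_by (ext_rot n ^+ k)%g); split.
- exists (conj_by (ext_rot n ^+ k)^-1%g) => v; first exact: conj_byK.
  by have := conj_byK (ext_rot n ^+ k)^-1%g v; rewrite invgK.
- exact: conj_byM.
move=> i; rewrite /gen_mod -(modzDmr i m) km.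
have [a ai] : exists a : 'I_n, (i %% n)%Z = a.
  have lt_a : (`|(i %% n)%Z| < n)%N by rewrite -ltz_nat gez0_abs ?modz_ge0 // ltz_pmod.
  by exists (Ordinal lt_a); rewrite /= gez0_abs ?modz_ge0.
rewrite -modzDml ai -PoszD modz_nat /=.
have lt_ak : ((a + k) %% n < n)%N by rewrite ltn_mod.
case: insubP => [b _ ba|]; last by rewrite ltn_ord.
have -> : b = a by apply: val_inj.
case: insubP => [c _ ck|]; last by rewrite lt_ak.
have -> : c = iter k (@ordS n) a.
  apply: val_inj; rewrite /= ck; elim: (k) => [|j IH].
    by rewrite addn0 modn_small.
  by rewrite iterS /= -IH addnS -[in RHS]addn1 modnDml addn1.
elim: k {km lt_ak c ck} => [|k IH].
  by apply: val_inj; rewrite /= expg0 mul1g invg1 mulg1.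
by rewrite expgS conj_by_comp IH conj_rot_gen.
Qed.

Definition length_bound (n : nat) (f : nat -> rat) : Prop :=
  (exists a c : rat, 0 < a /\ forall z : nat, f z = a * z%:R + c) /\
  forall (m : int) (beta : affine_weyl n -> affine_weyl n),
    coprimez m n -> is_beta m beta ->
    forall v : affine_weyl n, f (len v) <= (len (beta v * v^-1)%g)%:R.

(* Main.v *)
Require Import Defs.
From mathcomp Require Import all_boot all_order all_algebra all_fingroup.
From mathcomp Require Import boolp classical_sets cardinality reals.
From mathcomp Require Import zify ring.

(** Let W_a act on the integers by affine permutations x with
    x (i + n) = x i + n. The generator s_k exchanges k - 1 and k modulo n, so
    the relation beta (s_k) = s_(k+m) integrates to beta(v) (i + m) = v i + m
    for every v ([act_beta]). Put w = beta(v) v^-1 and g i = v i - i, an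
    n-periodic function. Then w (v (i + m)) = v i + m, hence
      g i - g (i + m) = w z - z    with z = v (i + m):
    the variation of g along steps of length m is the displacement of w.

    On one side, multiplication by a generator adds at most 2 to the total
    displacement sum_z |w z - z| over a period, so the latter is at most
    2 l(w) ([displacement_le_len]). As m is coprime to n, the steps i, i + m,
    i + 2 m, ... visit each residue once and come back to i, and any two values
    of g are joined by two complementary arcs of this cycle. One of the arcs
    has at most half of the total variation, so |g j - g i| <= l(w) for all
    i and j ([oscillation_le]).

    On the other side, l(v) is at most the number of inversions of v
    ([len_le_inversions]), and a pair of residue classes in which g differs by
    at most L contributes at most (L + n - 1) / n inversions
    ([crossings_le]). Summing over the n (n - 1) / 2 pairs gives
      2 l(v) <= (n - 1) (l(w) + n - 1)    ([len_beta_ge]),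
    that is l(w) >= 2 l(v) / (n - 1) - (n - 1), which implies the bound
    claimed because (n - 1)^2 <= 2 n (2 n - 3). Finiteness follows since there
    are finitely many words of bounded length. *)

Set Implicit Arguments.
Unset Strict Implicit.
Unset Printing Implicit Defensive.

Import Order.TTheory GRing.Theory Num.Theory.
Local Open Scope ring_scope.

(** * Affine permutations of the integers *)

Section ActionOnIntegers.
Variable n : nat.
Hypothesis n_ge2 : (2 <= n)%N.
Implicit Types (i j k a b : int) (x y : ext_affine n).

Let n_neq0 : (n : int) != 0. Proof. by rewrite -lt0n ltnW. Qed.
Let n_gt0 : 0 < (n : int). Proof. by rewrite ltz_nat ltnW. Qed.

Let modzMDr i a : (i + a * n = i %[mod n])%Z.
Proof. by rewrite addrC modzMDl. Qed.

Lemma residue_subproof i : (`|(i %% n)%Z| < n)%N.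
Proof. by rewrite -ltz_nat gez0_abs ?modz_ge0 // ltz_pmod. Qed.

Definition residue i : 'I_n := Ordinal (residue_subproof i).

Lemma residueE i : Posz (residue i) = (i %% n)%Z.
Proof. by rewrite /= gez0_abs ?modz_ge0. Qed.

Lemma residue_eq i : i = Posz (residue i) + (i %/ n)%Z * n.
Proof. by rewrite residueE addrC -divz_eq. Qed.

Lemma divz_ordD (r : 'I_n) a : ((Posz r + a * n) %/ n)%Z = a.
Proof. by rewrite addrC divzMDl // divz_small ?addr0 //= ?absz_nat ltz_nat ltn_ord. Qed.

Lemma residue_ordD (r : 'I_n) a : residue (Posz r + a * n) = r.
Proof.
apply/val_inj/eqP; rewrite -eqz_nat residueE modzMDr modz_small //.
by rewrite ltz_nat ltn_ord.
Qed.

Lemma eqmodzP i j : (exists a, i = j + a * n) <-> (i = j %[mod n])%Z.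
Proof.
split=> [[a ->]|ij]; first by rewrite modzMDr.
exists ((i %/ n)%Z - (j %/ n)%Z).
by rewrite {1}(divz_eq i n) ij {2}(divz_eq j n); ring.
Qed.

Lemma eq_residue i j : (i = j %[mod n])%Z -> residue i = residue j.
Proof. by move=> ij; apply/val_inj/eqP; rewrite -eqz_nat !residueE ij. Qed.

(** The basis vectors e_i, for i in Z with e_(i+n) = eps e_i, are permuted by
    the extended affine Weyl group; this is the induced action on indices. *)
Definition act x i : int :=
  let j := linear_part x (residue i) in Posz j + (transl x j + (i %/ n)%Z) * n.

Lemma act_ordD x (r : 'I_n) a :
  act x (Posz r + a * n) =
  Posz (linear_part x r) + (transl x (linear_part x r) + a) * n.
Proof. by rewrite /act residue_ordD divz_ordD. Qed.

Lemma act1 i : act 1%g i = i.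
Proof. by rewrite /act perm1 ffunE add0r -residue_eq. Qed.

Lemma actM x y i : act (x * y)%g i = act x (act y i).
Proof.
rewrite (residue_eq i) !act_ordD /= permM !ffunE permK; ring.
Qed.

Lemma actD x i a : act x (i + a * n) = act x i + a * n.
Proof.
by rewrite /act (@eq_residue _ i) ?modzMDr // divzDr ?dvdz_mull // mulzK //; ring.
Qed.

Lemma actK x : cancel (act x) (act x^-1%g).
Proof. by move=> i; rewrite -actM mulVg act1. Qed.

Lemma act_inj x : injective (act x).
Proof. exact: can_inj (actK x). Qed.

Lemma act_eqmod x i j : (act x i = act x j %[mod n])%Z -> (i = j %[mod n])%Z.
Proof.
case/eqmodzP=> a; rewrite -actD => /act_inj ->; exact: modzMDr.
Qed.

Lemma act_faithful x : act x =1 id -> x = 1%g.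
Proof.
move=> x_id.
have x_ord r : linear_part x r = r /\ transl x r = 0.
  have := x_id (Posz r + (0 : int) * n); rewrite act_ordD addr0.
  move=> E; have := congr1 residue E; rewrite !residue_ordD => xr.
  split=> //; move: E; rewrite xr mul0r => /addrI/eqP.
  by rewrite mulf_eq0 (negPf n_neq0) orbF => /eqP.
case: x {x_id} x_ord => l s /= x_ord; congr ExtAff.
- by apply/ffunP => r; rewrite ffunE (x_ord r).2.
- by apply/permP => r; rewrite perm1 (x_ord r).1.
Qed.

(** The sum of an n-periodic function over a system of representatives of the
    residues does not depend on the system; it is used for the systems obtained
    from an affine permutation and from the multiples of m. *)
Lemma sum_period (F sigma : int -> int) :
    (forall i a, F (i + a * n) = F i) ->
    (forall i j, (sigma i = sigma j %[mod n])%Z -> (i = j %[mod n])%Z) ->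
  \sum_(r < n) F (sigma r) = \sum_(r < n) F r.
Proof.
move=> F_per sigma_inj.
rewrite [RHS](reindex_inj (h := fun r : 'I_n => residue (sigma r))) /=.
  by apply: eq_bigr => r _; rewrite {1}(residue_eq (sigma r)) F_per.
move=> r q /(congr1 (Posz \o val)); rewrite /comp !residueE => /sigma_inj E.
by rewrite -(residue_ordD r 0) -(residue_ordD q 0) !mul0r !addr0 (eq_residue E).
Qed.

(** * Simple reflections *)

(** For an arbitrary integer k this is the affine permutation s_(k mod n). *)
Definition simple_refl k i : int :=
  if (i == k %[mod n])%Z then i - 1
  else if (i == k - 1 %[mod n])%Z then i + 1 else i.

(** The translation by m conjugates s_k to s_(k+m): this is where beta_m acts
    as a shift of the integers. *)
Lemma simple_reflD k i m : simple_refl (k + m) (i + m) = simple_refl k i + m.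
Proof.
rewrite /simple_refl (addrAC k) !eqz_modDr.
case: ifP => _; first exact: addrAC.
by case: ifP => _; first exact: addrAC.
Qed.

Lemma neq_pred_mod i : (i == i - 1 %[mod n])%Z = false.
Proof.
by rewrite eqz_mod_dvd opprB addrC subrK dvdz1 absz_nat gtn_eqF.
Qed.

Lemma eq_ord_mod (r q : 'I_n) : (Posz r == Posz q %[mod n])%Z = (r == q).
Proof. by rewrite !modz_small ?ltz_nat ?ltn_ord. Qed.

Lemma eq_residue_mod i (r : 'I_n) : (residue i == r) = (i == Posz r %[mod n])%Z.
Proof. by rewrite -eq_ord_mod residueE modz_mod. Qed.

Lemma ord_pred_mod (r : 'I_n) : (Posz (ord_pred r) = Posz r - 1 %[mod n])%Z.
Proof.
rewrite -modz_nat modz_mod -subn1.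
rewrite -subzn; last by rewrite (leq_trans (ltnW n_ge2)) // leq_addl.
by rewrite PoszD addrAC modzDr.
Qed.

(** For r = 0 the coroot in the translation part of s_0 moves the exchanged
    entries by n, which turns the transposition of 0 and n - 1 into the exchange
    of the neighbours -1 and 0. *)
Lemma act_gen (r : 'I_n) i : act (ext_gen r) i = simple_refl r i.
Proof.
have pr_neq : (ord_pred r == r) = false.
  by rewrite -eq_ord_mod ord_pred_mod eq_sym neq_pred_mod.
have pred_r : Posz (ord_pred r) = Posz r - 1 + (r == 0%N :> nat)%:Z * n.
  have [r0|r_neq0] := eqVneq (r : nat) 0%N.
    by rewrite /= r0 add0n modn_small ?prednK; lia.
  by rewrite ord_pred_val ?lt0n //; lia.
rewrite {1}(residue_eq i) act_ordD /simple_refl -eq_residue_mod -ord_pred_mod.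
rewrite -eq_residue_mod /=.
have [iq|iq] := eqVneq (residue i) r.
  rewrite iq tpermR pred_r [in RHS](residue_eq i) iq.
  by case: eqP => _; rewrite !ffunE ?eqxx ?pr_neq /=; ring.
have [ip|ip] := eqVneq (residue i) (ord_pred r).
  rewrite ip tpermL [in RHS](residue_eq i) ip pred_r.
  by case: eqP => _; rewrite !ffunE ?eqxx ?[r == _]eq_sym ?pr_neq /=; ring.
rewrite tpermD ?[_ == residue i]eq_sym // [RHS](residue_eq i).
by case: eqP => _; rewrite !ffunE ?(negPf ip) ?(negPf iq) /=; ring.
Qed.

Lemma simple_reflK k : involutive (simple_refl k).
Proof.
move=> i; rewrite {2}/simple_refl.
case: ifP => [ik|ik]; last case: ifP => [ip|ip].
- rewrite /simple_refl; have -> : (i - 1 == k - 1 %[mod n])%Z by rewrite eqz_modDr.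
  case: ifP => [E|_]; last exact: subrK.
  by have := neq_pred_mod i; rewrite (eqP E) (eqP ik) eqxx.
- rewrite /simple_refl; have -> : (i + 1 == k %[mod n])%Z; last exact: addrK.
  by rewrite -[X in (_ == X %[mod _])%Z](subrK 1) eqz_modDr.
- by rewrite /simple_refl ik ip.
Qed.

Lemma simple_refl_inj k : injective (simple_refl k).
Proof. exact: inv_inj (simple_reflK k). Qed.

Lemma ext_genK (r : 'I_n) : (ext_gen r * ext_gen r = 1)%g.
Proof. by apply: act_faithful => i; rewrite actM !act_gen simple_reflK. Qed.

Lemma act_gen_mod k i : act (ext_val (gen_mod n k)) i = simple_refl k i.
Proof.
rewrite /gen_mod; case: insubP => [r _ rk|]; last by rewrite residue_subproof.
rewrite /= act_gen /simple_refl -modzDml.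
have -> : Posz r = (k %% n)%Z by rewrite -residueE; congr Posz.
by rewrite modz_mod modzDml.
Qed.

(** * Displacement bounds length from below *)

Definition displacement x : int := \sum_(r < n) `|act x r - Posz r|.

(** The term |x (y r) - r| is split at y r, and y r runs over a system of
    residues. *)
Lemma displacementM x y :
  displacement (x * y)%g <= displacement x + displacement y.
Proof.
rewrite /displacement.
rewrite -(@sum_period (fun i => `|act x i - i|) (act y)); last 2 first.
- by move=> i a; rewrite actD; congr `|_|; ring.
- exact: act_eqmod.
rewrite -big_split /=; apply: ler_sum => r _; rewrite actM.
by apply: le_trans (ler_normD _ _); rewrite addrA subrK.
Qed.

Lemma sum_eq_ord (q : 'I_n) : \sum_(r < n) (r == q)%:Z = 1.
Proof. by rewrite (bigD1 q) //= eqxx big1 ?addr0 // => r /negPf->. Qed.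

Lemma displacement_gen r : displacement (ext_gen r) <= 2.
Proof.
have -> : (2 : int) = \sum_(q < n) (q == r)%:Z + \sum_(q < n) (q == ord_pred r)%:Z.
  by rewrite !sum_eq_ord.
rewrite -big_split /=; apply: ler_sum => q _; rewrite act_gen /simple_refl.
rewrite eq_ord_mod -ord_pred_mod eq_ord_mod /=.
by case: (q == r); case: (q == _); lia.
Qed.

(** * Inversions bound length from above *)

Let divzDM a b : ((a + b * n) %/ n)%Z = (a %/ n)%Z + b.
Proof. by rewrite (addrC a) divzMDl // addrC. Qed.

Lemma divz_unique (f : int) a : f * n <= a < (f + 1) * n -> (a %/ n)%Z = f.
Proof.
move=> /andP[fa af]; apply/eqP; rewrite eq_le lez_divRL // fa andbT.
by rewrite -ltzD1 ltz_divLR.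
Qed.

Lemma simple_reflDM k i a : simple_refl k (i + a * n) = simple_refl k i + a * n.
Proof.
rewrite /simple_refl modzMDr; case: ifP => _; first exact: addrAC.
by case: ifP => _; first exact: addrAC.
Qed.

(** The pairs of residue classes exchanged by s_k: only for them can s_k
    reverse the order of two integers. *)
Definition swapped k i j :=
  (i == k - 1 %[mod n])%Z && (j == k %[mod n])%Z
  || (i == k %[mod n])%Z && (j == k - 1 %[mod n])%Z.

Lemma swappedDM k i j a : swapped k (i + a * n) j = swapped k i j.
Proof. by rewrite /swapped !modzMDr. Qed.

Lemma swappedC k i j : swapped k i j = swapped k j i.
Proof. by rewrite /swapped orbC andbC [X in _ || X]andbC. Qed.

Lemma simple_refl_mono k i j :
  ~~ swapped k i j -> i <= j -> simple_refl k i <= simple_refl k j.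
Proof.
rewrite le_eqVlt => nsw /orP[/eqP->//|]; move: nsw; rewrite /swapped /simple_refl.
by do 4! case: (_ == _ %[mod _])%Z => //=; lia.
Qed.

Lemma simple_refl_lt k i j :
  ~~ swapped k i j -> i < j -> simple_refl k i < simple_refl k j.
Proof.
by move=> nsw ij; rewrite lt_neqAle (inj_eq (@simple_refl_inj k)) (lt_eqF ij)
  simple_refl_mono ?ltW.
Qed.

(** The quotient is the largest f with i + f n <= j, so it only depends on the
    relative order of j and the translates of i, which s_k preserves outside the
    swapped pairs. *)
Lemma divz_reflect k i j : ~~ swapped k i j ->
  ((simple_refl k j - simple_refl k i) %/ n)%Z = ((j - i) %/ n)%Z.
Proof.
move=> nsw; apply: divz_unique; set f := (_ %/ n)%Z.
have f_le : i + f * n <= j by rewrite addrC -lerBrDr lez_floor.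
have f_gt : j < i + (f + 1) * n by rewrite addrC -ltrBlDr ltz_ceil.
rewrite lerBrDl ltrBlDl -!simple_reflDM simple_refl_mono ?swappedDM //=.
by rewrite simple_refl_lt // swappedC swappedDM.
Qed.

(** For i and j incongruent modulo n, this is the number of translates j + a n
    whose order relative to i is reversed by x. Subtracting the quotient of
    j - i makes the count periodic and symmetric in i and j, so that it lives on
    pairs of residues and no generator has to be treated apart. *)
Definition crossings x i j : int :=
  `|((act x j - act x i) %/ n)%Z - ((j - i) %/ n)%Z|.

Lemma crossingsDMl x i j a : crossings x (i + a * n) j = crossings x i j.
Proof.
rewrite /crossings actD !opprD !addrA -!mulNr !divzDM; congr `|_|; ring.
Qed.

Lemma crossingsDMr x i j a : crossings x i (j + a * n) = crossings x i j.
Proof.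
rewrite /crossings actD ![_ + a * n - _]addrAC !divzDM; congr `|_|; ring.
Qed.

(** Right multiplication by s_k at a descent removes one crossing between the
    classes of k - 1 and k, and only permutes the other pairs of classes. *)
Lemma crossings_reflect x (k : 'I_n) i j : act x k < act x (Posz k - 1) ->
  crossings (x * ext_gen k)%g i j + (swapped k i j)%:Z
    <= crossings x (simple_refl k i) (simple_refl k j).
Proof.
move=> desc; case: (boolP (swapped k i j)) => [|nsw]; last first.
  by rewrite addr0 /crossings !actM !act_gen divz_reflect.
have r_k : simple_refl k k = Posz k - 1 by rewrite /simple_refl eqxx.
have r_p : simple_refl k (Posz k - 1) = k by rewrite -r_k simple_reflK.
have div1 : (1 %/ n)%Z = 0 by apply: divz_unique; lia.
have divN1 : (-1 %/ n)%Z = -1 by apply: divz_unique; lia.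
(* By periodicity it suffices to treat the pairs (p, k) and (k, p). *)
set p := Posz k - 1 in desc r_k r_p *.
have kp : Posz k - p = 1 by rewrite /p; ring.
have pk : p - Posz k = -1 by rewrite /p; ring.
case/orP=> /andP[/eqP/eqmodzP[a ->] /eqP/eqmodzP[b ->]];
  rewrite !simple_reflDM !crossingsDMl !crossingsDMr /crossings !actM !act_gen;
  rewrite r_p r_k kp pk div1 divN1.
  have : 0 <= ((act x p - act x k) %/ n)%Z by rewrite divz_ge0; lia.
  by lia.
have : ((act x k - act x p) %/ n)%Z < 0 by rewrite ltz_divLR //; lia.
by lia.
Qed.

(** The sum runs over ordered pairs of residues: it is twice the number of
    inversions of x. *)
Definition inversions x : int := \sum_(i < n) \sum_(j < n) crossings x i j.

Lemma inversions_reflect x (k : 'I_n) : act x k < act x (Posz k - 1) ->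
  inversions (x * ext_gen k)%g + 2 <= inversions x.
Proof.
move=> desc.
have simple_refl_eqmod i j :
    (simple_refl k i = simple_refl k j %[mod n])%Z -> (i = j %[mod n])%Z.
  by rewrite -!act_gen => /act_eqmod.
have -> : inversions x =
    \sum_(i < n) \sum_(j < n) crossings x (simple_refl k i) (simple_refl k j).
  rewrite (sum_period (F := fun i => \sum_(j < n) crossings x i (simple_refl k j))
                      _ simple_refl_eqmod).
    apply: eq_bigr => i _.
    by rewrite (sum_period _ simple_refl_eqmod) // => *; apply: crossingsDMr.
  by move=> i a; apply: eq_bigr => j _; apply: crossingsDMl.
suff <- : \sum_(i < n) \sum_(j < n) (swapped k i j)%:Z = 2.
  rewrite -big_split; apply: ler_sum => i _ /=.
  by rewrite -big_split; apply: ler_sum => j _; apply: crossings_reflect.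
set p := ord_pred k.
have pk : (p == k) = false.
  by rewrite -eq_ord_mod ord_pred_mod eq_sym neq_pred_mod.
have E (i j : 'I_n) : (swapped k i j)%:Z =
    (i == p)%:Z * (j == k)%:Z + (i == k)%:Z * (j == p)%:Z.
  rewrite /swapped -ord_pred_mod !eq_ord_mod -/p.
  have [->|_] := eqVneq i p; first by rewrite pk !(mul1r, mul0r) addr0 orbF.
  by rewrite mul0r add0r; case: (i == k); rewrite ?mul1r ?mul0r.
transitivity (\sum_(i < n) ((i == p)%:Z + (i == k)%:Z)); last first.
  by rewrite big_split /= !sum_eq_ord.
apply: eq_bigr => i _; under eq_bigr do rewrite E.
rewrite big_split /= -!mulr_sumr.
by rewrite !sum_eq_ord !mulr1.
Qed.

(** If x has no descent then x i - i is nondecreasing, hence constant by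
    periodicity, and the constant vanishes because the translation part of x
    has sum 0. *)
Lemma ascending_eq1 x : in_affine_weyl x ->
  (forall k : 'I_n, act x (Posz k - 1) <= act x k) -> x = 1%g.
Proof.
move=> /eqP sum0 asc_ord; apply: act_faithful.
have asc i : act x i - i <= act x (i + 1) - (i + 1).
  suff: act x i != act x (i + 1) /\ act x i <= act x (i + 1) by lia.
  split; first by rewrite (inj_eq (@act_inj x)); lia.
  rewrite -{1}(addrK 1 i) (residue_eq (i + 1)) addrAC !actD lerD2r.
  exact: asc_ord.
have asc_nat i (a : nat) : act x i - i <= act x (i + a%:Z) - (i + a%:Z).
  elim: a => [|a IH]; first by rewrite addr0.
  by apply: le_trans IH _; rewrite -addn1 PoszD addrA.
have const i : act x i - i = act x 0.
  have E (r : 'I_n) a : act x (Posz r + a * n) - (Posz r + a * n) = act x r - Posz r.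
    by rewrite actD; ring.
  rewrite (residue_eq i) E; set r := residue i.
  apply: le_anti; have := asc_nat 0 r; rewrite add0r subr0 => ->.
  have := asc_nat r (n - r)%N; rewrite -PoszD subnKC ?andbT; last exact: ltnW.
  by have := actD x 0 1; rewrite mul1r add0r => ->; rewrite addrK.
suff act0 : act x 0 = 0 by move=> i; have := const i; rewrite act0 => /subr0_eq.
have: \sum_(r < n) (act x r - Posz r) = 0.
  have reindex_perm (F : 'I_n -> int) :
      \sum_(r < n) F (linear_part x r) = \sum_(r < n) F r.
    by rewrite [RHS](reindex_inj (@perm_inj _ (linear_part x))).
  have E (r : 'I_n) : act x r =
      Posz (linear_part x r) + transl x (linear_part x r) * n.
    by have := act_ordD x r 0; rewrite mul0r !addr0.
  under eq_bigr => r _ do rewrite E.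
  rewrite sumrB big_split /= -mulr_suml.
  rewrite (reindex_perm (fun r => Posz r)) (reindex_perm (transl x)).
  by rewrite sum0 mul0r addr0 subrr.
under eq_bigr do rewrite const.
rewrite sumr_const card_ord => /eqP; rewrite mulrn_eq0.
by case: (n) n_ge2 => //= n' _ /eqP.
Qed.

Lemma inversions_ge0 x : 0 <= inversions x.
Proof. by do 2! (apply: sumr_ge0 => ? _). Qed.

(** Sorting: descents are removed until none is left, and each removal lowers
    the count, which is twice the number of inversions, by at least 2. *)
Lemma word_of_inversions (v : affine_weyl n) :
  exists t : seq 'I_n,
    (\prod_(i <- t) gen i)%g = v /\ 2 * (size t)%:Z <= inversions (ext_val v).
Proof.
have [N] : exists N : nat, inversions (ext_val v) < N%:Z.
  exists `|inversions (ext_val v)|.+1.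
  by rewrite -addn1 PoszD gez0_abs ?inversions_ge0 // ltzD1.
elim: N v => [|N IH] v ltN; first by rewrite ltNge inversions_ge0 in ltN.
case: (pickP (fun k : 'I_n =>
    act (ext_val v) k < act (ext_val v) (Posz k - 1))) => [k desc|asc].
  have le2 := inversions_reflect desc.
  have vk : ext_val (v * gen k)%g = (ext_val v * ext_gen k)%g by [].
  have [|t [tv tsz]] := IH (v * gen k)%g; first by rewrite vk; lia.
  exists (rcons t k); split; last by rewrite size_rcons; move: tsz; rewrite vk; lia.
  rewrite -cats1 big_cat big_seq1 /= tv -mulgA.
  have -> : (gen k * gen k = 1)%g by apply: val_inj; apply: ext_genK.
  by rewrite mulg1.
exists [::]; rewrite big_nil inversions_ge0; split=> //.
apply/esym/val_inj/ascending_eq1 => [|k]; first exact: valP.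
by rewrite leNgt asc.
Qed.

(** Two quotients by n of numbers at distance at most L differ by at most
    (L + n - 1) / n. *)
Lemma crossings_le x i j (L : int) :
    `|(act x j - j) - (act x i - i)| <= L ->
  crossings x i j * n <= L + n%:Z - 1.
Proof.
move=> le_L; rewrite /crossings.
set a := act x j - act x i; set b := j - i.
have /andP[a1 a2] : (a %/ n)%Z * n <= a < ((a %/ n)%Z + 1) * n.
  by rewrite lez_floor // ltz_ceil.
have /andP[b1 b2] : (b %/ n)%Z * n <= b < ((b %/ n)%Z + 1) * n.
  by rewrite lez_floor // ltz_ceil.
have {}le_L : `|a - b| <= L by congr (`|_| <= L): le_L; rewrite /a /b; ring.
(* With n moved inside the absolute value, both quotients occur only multiplied
   by n, and the goal becomes linear in these products. *)
rewrite -[in X in _ * X](gtr0_norm n_gt0) -normrM mulrBl.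
move: a1 a2 b1 b2 le_L; rewrite !mulrDl !mul1r.
by move: ((a %/ n)%Z * n) ((b %/ n)%Z * n) => ? ?; lia.
Qed.

Lemma crossingsii x i : crossings x i i = 0.
Proof. by rewrite /crossings !subrr normr0. Qed.

Lemma inversions_le x (L : int) :
    (forall i j, `|(act x j - j) - (act x i - i)| <= L) ->
  inversions x <= (n%:Z - 1) * (L + n%:Z - 1).
Proof.
move=> le_L; rewrite -(ler_pM2r n_gt0) mulr_suml -[X in _ <= _ * X]natz mulr_natr.
rewrite -[X in _ *+ X]card_ord -sumr_const; apply: ler_sum => r _.
rewrite mulr_suml (bigD1 r) //= crossingsii mul0r add0r.
apply: (@le_trans _ _ (\sum_(q < n | q != r) (L + n%:Z - 1))).
  by apply: ler_sum => q _; apply: crossings_le.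
rewrite sumr_const cardC1 card_ord -mulr_natl.
by rewrite -subn1 natrB ?natz; last exact: ltnW.
Qed.

(** * Comparison with the length *)

Lemma len_word (v : affine_weyl n) :
  exists2 t : seq 'I_n, size t = len v & (\prod_(i <- t) gen i)%g = v.
Proof.
rewrite /len; case: ex_minnP => k /existsP[t /eqP tv] _.
by exists t; rewrite ?size_tuple.
Qed.

Lemma len_le (t : seq 'I_n) : (len (\prod_(i <- t) gen i)%g <= size t)%N.
Proof.
rewrite /len; case: ex_minnP => k _; apply.
by apply/existsP; exists (in_tuple t).
Qed.

Lemma len_le_inversions (v : affine_weyl n) :
  2 * (len v)%:Z <= inversions (ext_val v).
Proof.
have [t [<-]] := word_of_inversions v; apply: le_trans.
by rewrite ler_pM2l // lez_nat len_le.
Qed.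

Lemma displacement_le_len (v : affine_weyl n) :
  displacement (ext_val v) <= 2 * (len v)%:Z.
Proof.
have [t <- {1}<-] := len_word v; elim: t => [|k t IH].
  by rewrite big_nil /displacement big1 // => r _; rewrite act1 subrr normr0.
rewrite big_cons; apply: le_trans (displacementM _ _) _.
by have := displacement_gen k; move: IH => /=; lia.
Qed.

(** * Twisted conjugation *)

Lemma act_beta m beta (v : affine_weyl n) i : is_beta m beta ->
  act (ext_val (beta v)) (i + m) = act (ext_val v) i + m.
Proof.
case=> _ betaM beta_gen; have [t _ <-] := len_word v.
elim: t i => [|k t IH] i.
  have -> : (\prod_(j <- [::]) gen j)%g = 1%g :> affine_weyl n by rewrite big_nil.
  have -> : beta 1%g = 1%g by apply: (mulgI (beta 1%g)); rewrite -betaM !mulg1.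
  by rewrite !act1.
rewrite big_cons betaM !actM IH -gen_modE beta_gen !act_gen_mod.
exact: simple_reflD.
Qed.

Lemma exists_step m i j : coprimez m n ->
  exists a : 'I_n, (i + a%:Z * m = j %[mod n])%Z.
Proof.
case/coprimezP=> [[u w] /= uw].
exists (residue (u * (j - i))); rewrite residueE -modzDmr modzMml modzDmr.
apply/eqmodzP; exists (- w * (j - i)).
rewrite -[X in _ = X + _](subrK i) -[X in _ = X + _ + _]mul1r -uw; ring.
Qed.

(** The points i, i + m, ..., i + n m = i modulo n form a cycle through all
    residues. The variation of g along each of the two arcs between i and j is
    at least |g j - g i|, and the two add up to the right-hand side. *)
Lemma oscillation_le (g : int -> int) m i j : coprimez m n ->
    (forall z a, g (z + a * n) = g z) ->
  2 * `|g j - g i| <= \sum_(r < n) `|g (Posz r + m) - g r|.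
Proof.
move=> co g_per; have [a /esym/eqmodzP[b ->]] := exists_step i j co.
rewrite g_per {j b}.
pose step (b : nat) := g (i + b%:Z * m).
have stepS z : g (i + z.+1%:Z * m) = g (i + z%:Z * m + m).
  by congr g; rewrite -addn1 PoszD; ring.
rewrite -(@sum_period (fun z : int => `|g (z + m) - g z|)
                      (fun z : int => i + z * m)); last 2 first.
- by move=> z c; rewrite [_ + _ + m]addrAC !g_per.
- move=> z y /eqP; rewrite eqz_modDl eqz_mod_dvd -mulrBl Gauss_dvdzl.
    by rewrite -eqz_mod_dvd => /eqP.
  by rewrite coprimez_sym.
under eq_bigr => r _ do rewrite -stepS.
rewrite -(big_mkord xpredT (fun b : nat => `|step b.+1 - step b|)).
rewrite (big_cat_nat _ (ltnW (ltn_ord a))) //=.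
have le1 : `|step a - step 0| <= \sum_(0 <= z < a) `|step z.+1 - step z|.
  by rewrite -(telescope_sumr _ (leq0n a)); apply: ler_norm_sum.
have le2 : `|step n - step a| <= \sum_(a <= z < n) `|step z.+1 - step z|.
  by rewrite -(telescope_sumr _ (ltnW (ltn_ord a))); apply: ler_norm_sum.
have stepn : step n = g i by rewrite /step mulrC g_per.
have step0 : step 0 = g i by rewrite /step mul0r addr0.
move: le1 le2; rewrite stepn step0 -/(step a) => le1 le2.
by rewrite mulr2n mulrDl !mul1r lerD // distrC.
Qed.

(** The main estimate; the displacement of w = beta(v) v^-1 is summed over the
    representatives v (i + m), where it equals the variation of i |-> v i - i
    along a step m. *)
Lemma len_beta_ge m beta (v : affine_weyl n) : coprimez m n -> is_beta m beta ->
  (2 * len v <= (n - 1) * (len (beta v * v^-1)%g + n - 1))%N.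
Proof.
move=> co beta_m; set w := (beta v * v^-1)%g.
set x := ext_val v; pose g i := act x i - i.
have g_per i a : g (i + a * n) = g i by rewrite /g actD; ring.
have act_w i : act (ext_val w) (act x (i + m)) = act x i + m.
  by rewrite -actM /= -mulgA mulVg mulg1 act_beta.
have dispE : \sum_(r < n) `|g (Posz r + m) - g r| = displacement (ext_val w).
  rewrite /displacement.
  rewrite -(@sum_period (fun i => `|act (ext_val w) i - i|)
                        (fun i => act x (i + m))).
  - by apply: eq_bigr => r _; rewrite act_w distrC /g; congr `|_|; ring.
  - by move=> i a; rewrite actD; congr `|_|; ring.
  - by move=> i j /act_eqmod/eqP; rewrite eqz_modDr => /eqP.
have g_le i j : `|g j - g i| <= (len w)%:Z.
  have := oscillation_le i j co g_per; rewrite dispE.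
  by have := displacement_le_len w; lia.
have := le_trans (len_le_inversions v) (inversions_le g_le).
by move: (len v) (len w) n_ge2; nia.
Qed.

(** * The length bound and finiteness *)

Lemma finite_len_le N : finite_set [set v : affine_weyl n | (len v <= N)%N]%classic.
Proof.
pose word (s : {k : 'I_N.+1 & k.-tuple 'I_n}) := (\prod_(i <- tagged s) gen i)%g.
apply: (@sub_finite_set _ _ (word @` setT)%classic); last first.
  by apply: finite_image; apply: finite_finset.
move=> v /= le_N; have [t tv tE] := len_word v.
have lt_N : (size t < N.+1)%N by rewrite tv ltnS.
by exists (Tagged (fun k : 'I_N.+1 => k.-tuple 'I_n)
            (in_tuple t : (Ordinal lt_N).-tuple 'I_n)).
Qed.

End ActionOnIntegers.

Local Open Scope classical_set_scope.

Theorem proposition4p1 (n : nat) (n_ge2 : (2 <= n)%N) :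
  [/\ exists f : nat -> rat, length_bound n f,
      forall (m : int) (beta : affine_weyl n -> affine_weyl n),
        coprimez m n -> is_beta m beta ->
        (forall w : affine_weyl n,
           finite_set [set v : affine_weyl n | (beta v * v^-1)%g = w]) /\
        (forall (R : realType) (r : R), 0 < r ->
           finite_set [set v : affine_weyl n |
                        (len (beta v * v^-1)%g)%:R < r]) &
      length_bound n (fun z : nat =>
        2 / (n%:R - 1) * z%:R - 2 * n%:R * (2 * n%:R - 3) / (n%:R - 1))].
Proof.
have bound : length_bound n (fun z : nat =>
    2 / (n%:R - 1) * z%:R - 2 * n%:R * (2 * n%:R - 3) / (n%:R - 1)).
  have n1_gt0 : 0 < n%:R - 1 :> rat by rewrite subr_gt0 ltr1n.
  split.
    exists (2 / (n%:R - 1)), (- (2 * n%:R * (2 * n%:R - 3) / (n%:R - 1))).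
    by split; first by rewrite divr_gt0.
  move=> m beta co beta_m v.
  have := len_beta_ge n_ge2 v co beta_m; set L := len (beta v * _)%g.
  have le_c : ((n - 1) * (n - 1) <= 2 * n * (2 * n - 3))%N by apply: leq_mul; lia.
  rewrite -addnBA ?mulnDr; last exact: ltnW.
  move=> /leq_trans/(_ (leq_add (leqnn _) le_c)).
  have n1E : (n - 1)%:R = n%:R - 1 :> rat by rewrite natrB // ltnW.
  have n3E : (2 * n - 3)%:R = 2 * n%:R - 3 :> rat.
    by rewrite natrB ?natrM //; lia.
  rewrite -(ler_nat rat) natrD [X in X <= _]natrM [X in _ <= X + _]natrM n1E.
  rewrite [X in _ <= _ + X]natrM n3E [X in _ <= _ + X * _]natrM => le_L.
  rewrite [_ / _ * _]mulrAC -mulrBl ler_pdivrMr // lerBlDr.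
  by rewrite [L%:R * _]mulrC.
split=> // [|m beta co beta_m]; first by eexists; exact: bound.
have fin N : finite_set [set v : affine_weyl n | (len (beta v * v^-1)%g <= N)%N].
  apply: sub_finite_set (finite_len_le n ((n - 1) * (N + n - 1))%N).
  move=> v /= le_N; apply: leq_trans (leq_pmull _ (isT : 0 < 2)%N) _.
  apply: leq_trans (len_beta_ge n_ge2 v co beta_m) _.
  by rewrite leq_mul2l leq_sub2r ?leq_add2r ?orbT.
split=> [w|R r _].
  by apply: sub_finite_set (fin (len w)) => v /= ->.
apply: sub_finite_set (fin (Num.truncn r)) => v /= lt_r.
by rewrite truncn_ge_nat ltW // (le_lt_trans _ lt_r).
Qed.
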